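(* Let $\mathcal{P}$ be a collection of probability distributions on $\mathcal{Z}^{n+1}$, let $\mathcal{E}:\mathcal{Z}^{n+1}\to[0,\infty]$ be a fuzzy prediction set that is valid for $\mathcal{P}$, and let $L_z:\mathcal{D}\to\mathbb{R}$, $z\in\mathcal{Z}$, be a loss function on a decision space $\mathcal{D}$. Assume $L_z>0$ for all $z$ and $\mathcal{E}^{Z^n}>0$. For every $Z^n$-dependent decision rule $\delta$, $$\mathrm{E}^P\left[\frac{L_{Z_{n+1}}(\delta)}{\sup_{z\in\mathcal{Z}}L_z(\delta)/\mathcal{E}^{Z^n}(z)}\right]\le1,\quad\text{for every }P\in\mathcal{P}.$$
   Context: $\mathcal{Z}$ is a measurable sample space and $Z^{n+1}=(Z^n,Z_{n+1})$ denotes a random element of $\mathcal{Z}^{n+1}$. A fuzzy prediction set is a measurable map $\mathcal{E}:\mathcal{Z}^{n+1}\to[0,\infty]$, with $\mathcal{E}^{z^n}(z)=\mathcal{E}(z^n,z)$; it is valid for $\mathcal{P}$ if $\mathrm{E}^P[\mathcal{E}^{Z^n}(Z_{n+1})]\le1$ for every $P\in\mathcal{P}$. A $Z^n$-dependent decision rule is a (measurable) map $\delta$ from $\mathcal{Z}^n$ to $\mathcal{D}$, with $\delta$ also denoting $\delta(Z^n)$. Conventions for $x\in(0,\infty)$: $x/\infty=0$ and $x/0=\infty$. The random variable inside the expectation is assumed measurable. *)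

(* Defs.v *)
From HB Require Import structures.
From mathcomp Require Import all_boot all_order all_algebra.
From mathcomp Require Import all_classical all_reals all_analysis.
From mathcomp Require Import measurable_realfun.

Set Implicit Arguments.
Unset Strict Implicit.
Unset Printing Implicit Defensive.

Import Order.TTheory GRing.Theory Num.Theory.
Import numFieldNormedType.Exports.

Local Open Scope classical_set_scope.
Local Open Scope ring_scope.
Local Open Scope ereal_scope.

(* Z^(n+1) is split as (Z^n, Z_(n+1)): a point w is a pair whose component w.1
   is the observed sample and w.2 the next observation.  The sigma-algebra is the
   library's product one, on tuples as well as on the pair. *)
Notation sample n Z := (n.-tuple Z * Z)%type.

Section FuzzyPredictionSets.
Context (R : realType) (d : measure_display) (Z : measurableType d) (n : nat).

(* The value +oo is allowed. *)
Definition fuzzy_prediction_set (E : sample n Z -> \bar R) : Prop :=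
  measurable_fun [set: sample n Z] E /\ (forall w, 0 <= E w).

(* The library's 'E_P[X] is restricted to real-valued X, so the expectation of
   an extended-real-valued variable is written as an integral. *)
Definition valid_for (PP : set (probability (sample n Z) R))
    (E : sample n Z -> \bar R) : Prop :=
  forall P, PP P -> \int[P]_w E (w.1, w.2) <= 1.

(* Division in \bar R satisfies x / +oo = 0 and x / 0 = +oo for 0 < x < +oo, and
   its other degenerate cases do not occur when L and E are positive. *)
Definition loss_ratio (D : Type) (L : Z -> D -> R) (E : sample n Z -> \bar R)
    (delta : n.-tuple Z -> D) (w : sample n Z) : \bar R :=
  (L w.2 (delta w.1))%:E /
  ereal_sup [set (L z (delta w.1))%:E / E (w.1, z) | z in [set: Z]].

End FuzzyPredictionSets.

(* Main.v *)
(* Keeping only the term z = Z_{n+1} of the supremum bounds the ratio pointwise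
   by E(Z^n, Z_{n+1}), whose expectation is at most 1 by validity. *)

Require Import Defs.
From HB Require Import structures.
From mathcomp Require Import all_boot all_order all_algebra.
From mathcomp Require Import all_classical all_reals all_analysis.
From mathcomp Require Import measurable_realfun.

Set Implicit Arguments.
Unset Strict Implicit.
Unset Printing Implicit Defensive.

Import Order.TTheory GRing.Theory Num.Theory.
Import numFieldNormedType.Exports.

Local Open Scope classical_set_scope.
Local Open Scope ring_scope.
Local Open Scope ereal_scope.

(** The supremum runs over every candidate [z], so it dominates the term of the observation actually
    drawn; inverting this, the loss cancels and [E] remains ([loss_ratio_le]). The bound holds at
    each sample point, whatever [delta] does, so one integration against [P] transfers validity from
    [E] to the ratio; [loss_ratio_ge0] supplies the sign needed for monotonicity of the integral. *)

Lemma loss_ratio_ge0 (R : realType) (d : measure_display)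
    (Z : measurableType d) (n : nat) (D : Type) (L : Z -> D -> R)
    (E : sample n Z -> \bar R) (delta : n.-tuple Z -> D) (w : sample n Z) :
  (forall z a, (0 <= L z a)%R) -> (forall w, 0 <= E w) ->
  0 <= loss_ratio L E delta w.
Proof.
move=> L_ge0 E_ge0; rewrite /loss_ratio mule_ge0 ?lee_fin ?inve_ge0//.
(* A supremum in [\bar R] is nonnegative once one member is; the index [w.2] provides one. *)
apply: le_ereal_sup_tmp; exists ((L w.2 (delta w.1))%:E / E (w.1, w.2)).
  by exists w.2.
by rewrite mule_ge0 ?lee_fin ?inve_ge0.
Qed.

Lemma loss_ratio_le (R : realType) (d : measure_display)
    (Z : measurableType d) (n : nat) (D : Type) (L : Z -> D -> R)
    (E : sample n Z -> \bar R) (delta : n.-tuple Z -> D) (w : sample n Z) :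
  (0 < L w.2 (delta w.1))%R -> 0 < E (w.1, w.2) ->
  loss_ratio L E delta w <= E (w.1, w.2).
Proof.
move=> L_gt0; rewrite /loss_ratio; set S := ereal_sup _.
have : (L w.2 (delta w.1))%:E / E (w.1, w.2) <= S.
  by apply: ereal_sup_ubound; exists w.2.
case: (E (w.1, w.2)) => [e||] //; last by rewrite leey.
rewrite lte_fin => LS e_gt0; move: LS.
rewrite inver gt_eqF// -EFinM.
(* An infinite supremum makes the ratio [0]; [-oo] is excluded by the finite lower bound on [S]. *)
case: S => [s||] //; last by rewrite invey mule0 lee_fin => _; exact: ltW.
rewrite lee_fin => Les.
(* Positivity of [s] makes [L / s <= e] and [L / e <= s] equivalent, both meaning [L <= e * s]. *)
have s_gt0 : (0 < s)%R by apply: lt_le_trans Les; rewrite divr_gt0.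
by rewrite inver gt_eqF// -EFinM lee_fin ler_pdivrMr// mulrC -ler_pdivrMr.
Qed.

Theorem proposition5 (R : realType)
    (dZ : measure_display) (Z : measurableType dZ) (n : nat)
    (dD : measure_display) (D : measurableType dD)
    (PP : set (probability (sample n Z) R))
    (E : sample n Z -> \bar R)
    (L : Z -> D -> R)
    (fuzzyE : fuzzy_prediction_set E)
    (validE : valid_for PP E)
    (L_gt0 : forall (z : Z) (a : D), (0 < L z a)%R)
    (E_gt0 : forall (zn : n.-tuple Z) (z : Z), 0 < E (zn, z)) :
  forall delta : n.-tuple Z -> D,
    measurable_fun [set: n.-tuple Z] delta ->
    measurable_fun [set: sample n Z] (loss_ratio L E delta) ->
    forall P : probability (sample n Z) R, PP P ->
      \int[P]_w loss_ratio L E delta w <= 1.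
Proof.
move=> delta _ mratio P PPP; have [mE E_ge0] := fuzzyE.
apply: le_trans (validE P PPP); apply: ge0_le_integral => //.
- by move=> w _; apply: loss_ratio_ge0 => // z a; exact: ltW.
(* The integrand [E (w.1, w.2)] agrees with [E w] only after destructing the pair. *)
- by apply: eq_measurable_fun mE => -[].
- by move=> w _; exact: loss_ratio_le.
Qed.
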